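(* Let $G$ be a free countable group. Then the exterior square $G\wedge G$ has a faithful representation into $SL_2(\mathbb{Z})$ and the tensor square $G\otimes G$ has a faithful representation into $GL_2(\mathbb{C})$.
   Context: With $x^y=y^{-1}xy$, the non-abelian tensor square $G\otimes G$ is the group generated by the symbols $g\otimes h$ ($g,h\in G$) subject to the relations $gg_1\otimes h=(g^{g_1}\otimes h^{g_1})(g_1\otimes h)$ and $g\otimes hh_1=(g\otimes h_1)(g^{h_1}\otimes h^{h_1})$ for all $g,g_1,h,h_1\in G$. The exterior square $G\wedge G$ is the quotient of $G\otimes G$ by the normal subgroup generated by all elements $g\otimes g$, $g\in G$. A faithful representation into a matrix group is an injective homomorphism into it. *)

(* Defs.v *)
From HB Require Import structures.
From mathcomp Require Import all_boot all_algebra generic_quotient.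
From mathcomp Require Import boolp classical_sets.

Set Implicit Arguments.
Unset Strict Implicit.
Unset Printing Implicit Defensive.

Local Open Scope classical_set_scope.
Local Open Scope quotient_scope.
Local Open Scope group_scope.

(* A letter (x, false) stands for the generator x, and (x, true) for its
   inverse; words are taken up to insertion and deletion of cancelling pairs. *)
Section FreeGroup.
Variable T : choiceType.
Implicit Types (s t u : seq (T * bool)).

Inductive word_equiv : seq (T * bool) -> seq (T * bool) -> Prop :=
| word_refl s : word_equiv s s
| word_sym s t : word_equiv s t -> word_equiv t s
| word_trans s t u : word_equiv s t -> word_equiv t u -> word_equiv s u
| word_cancel s t x b :
    word_equiv (s ++ [:: (x, b); (x, ~~ b)] ++ t) (s ++ t).

Definition word_rel : rel (seq (T * bool)) := fun s t => `[< word_equiv s t >].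

Lemma word_rel_equiv : equiv_class_of word_rel.
Proof.
split=> [s|s t|t s u]; first exact/asboolP/word_refl.
  by apply/asboolP/asboolP; apply: word_sym.
by move=> /asboolP st /asboolP tu; apply/asboolP/(word_trans st tu).
Qed.

Canonical word_rel_equiv_rel := EquivRelPack word_rel_equiv.

Definition free_group := {eq_quot word_rel}.

HB.instance Definition _ := Choice.on free_group.
HB.instance Definition _ := EqQuotient.on free_group.

Lemma free_group_eqP s t :
  reflect (word_equiv s t) (\pi_free_group s == \pi_free_group t).
Proof. by rewrite piE; apply: asboolP. Qed.

Lemma word_equiv_cat s s' t t' :
  word_equiv s s' -> word_equiv t t' -> word_equiv (s ++ t) (s' ++ t').
Proof.
move=> ss' tt'; apply: (@word_trans _ (s' ++ t)).
  elim: ss' => {s s'} [s|s s' _|s u s' _ h1 _|s s' x b].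
  - exact: word_refl.
  - exact: word_sym.
  - exact: word_trans h1.
  - by rewrite -!catA; apply: word_cancel.
elim: tt' => {t t'} [t|t t' _|t u t' _ h1 _|t t' x b].
- exact: word_refl.
- exact: word_sym.
- exact: word_trans h1.
- by rewrite catA [s' ++ (t ++ t')]catA; apply: word_cancel.
Qed.

Definition word_inv s := rev [seq (x.1, ~~ x.2) | x <- s].

Lemma word_inv_cat s t : word_inv (s ++ t) = word_inv t ++ word_inv s.
Proof. by rewrite /word_inv map_cat rev_cat. Qed.

Lemma word_invK s : word_inv (word_inv s) = s.
Proof.
rewrite /word_inv map_rev revK -map_comp -[RHS]map_id.
by apply: eq_map => -[x b] /=; rewrite negbK.
Qed.

Lemma word_equiv_inv s t :
  word_equiv s t -> word_equiv (word_inv s) (word_inv t).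
Proof.
elim=> {s t} [s|s t _|s t u _ h1 _|s t x b].
- exact: word_refl.
- exact: word_sym.
- exact: word_trans h1.
- by rewrite !word_inv_cat -catA; case: b; apply: word_cancel.
Qed.

Lemma word_mulV s : word_equiv (s ++ word_inv s) [::].
Proof.
elim/last_ind: s => [|s [x b] IHs]; first exact: word_refl.
rewrite -cats1 word_inv_cat -catA; apply: word_trans IHs.
exact: word_cancel.
Qed.

Definition free_one : free_group := \pi_free_group [::].
Definition free_mul (a b : free_group) : free_group := \pi_free_group (repr a ++ repr b).
Definition free_inv (a : free_group) : free_group := \pi_free_group (word_inv (repr a)).

Lemma repr_free s : word_equiv (repr (\pi_free_group s)) s.
Proof. by apply/free_group_eqP; rewrite reprK. Qed.

Lemma free_groupP (a : free_group) : exists s, a = \pi_free_group s.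
Proof. by exists (repr a); rewrite reprK. Qed.

Lemma free_mulE s t :
  free_mul (\pi_free_group s) (\pi_free_group t) = \pi_free_group (s ++ t).
Proof. by apply/eqP/free_group_eqP/word_equiv_cat; apply: repr_free. Qed.

Lemma free_invE s : free_inv (\pi_free_group s) = \pi_free_group (word_inv s).
Proof. exact/eqP/free_group_eqP/word_equiv_inv/repr_free. Qed.

Lemma free_mulA : associative free_mul.
Proof.
move=> a b c; have [s ->] := free_groupP a; have [t ->] := free_groupP b.
by have [u ->] := free_groupP c; rewrite !free_mulE catA.
Qed.

Lemma free_mul1 : left_id free_one free_mul.
Proof. by move=> a; have [s ->] := free_groupP a; rewrite free_mulE. Qed.

Lemma free_mulr1 : right_id free_one free_mul.
Proof. by move=> a; have [s ->] := free_groupP a; rewrite free_mulE cats0. Qed.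

Lemma free_mulrV : right_inverse free_one free_inv free_mul.
Proof.
move=> a; have [s ->] := free_groupP a; rewrite free_invE free_mulE.
exact/eqP/free_group_eqP/word_mulV.
Qed.

Lemma free_mulV : left_inverse free_one free_inv free_mul.
Proof.
move=> a; have [s ->] := free_groupP a; rewrite free_invE free_mulE -{2}[s]word_invK.
exact/eqP/free_group_eqP/word_mulV.
Qed.

HB.instance Definition _ :=
  isGroup.Build free_group free_mulA free_mul1 free_mulr1 free_mulV free_mulrV.

Definition free_gen (x : T) : free_group := \pi_free_group [:: (x, false)].

End FreeGroup.

Definition is_free (G : groupType) : Prop :=
  exists (T : choiceType) (f : {multiplicative free_group T -> G}), bijective f.

Definition normal_subgroup (G : groupType) (N : set G) : Prop :=
  [/\ N 1,
      forall x y, N x -> N y -> N (x * y),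
      forall x, N x -> N x^-1
    & forall x y, N x -> N (x ^ y)].

Definition normal_closure (G : groupType) (A : set G) : set G :=
  smallest (@normal_subgroup G) A.

Lemma normal_closure_normal (G : groupType) (A : set G) :
  normal_subgroup (normal_closure A).
Proof.
split=> [N [[]] //|x y Nx Ny N nN|x Nx N nN|x y Nx N nN].
- case: (nN) => -[_ mulN _ _] _; exact: mulN (Nx N nN) (Ny N nN).
- case: (nN) => -[_ _ invN _] _; exact: invN (Nx N nN).
- case: (nN) => -[_ _ _ conjN] _; exact: conjN (Nx N nN).
Qed.

Section QuotientByNormalClosure.
Variables (G : groupType) (A : set G).
Implicit Types x y z : G.

Let N := normal_closure A.
Let N1 : N 1. Proof. by case: (normal_closure_normal A). Qed.
Let NM x y : N x -> N y -> N (x * y).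
Proof. by case: (normal_closure_normal A) => _ h _ _; apply: h. Qed.
Let NV x : N x -> N x^-1.
Proof. by case: (normal_closure_normal A) => _ _ h _; apply: h. Qed.
Let NJ x y : N x -> N (x ^ y).
Proof. by case: (normal_closure_normal A) => _ _ _ h; apply: h. Qed.

Definition coset_rel : rel G := fun x y => `[< normal_closure A (x^-1 * y) >].

Lemma coset_rel_equiv : equiv_class_of coset_rel.
Proof.
have sym x y : coset_rel x y -> coset_rel y x.
  by move=> /asboolP/NV; rewrite invgM invgK => h; apply/asboolP.
split=> [x|x y|y x z]; first by apply/asboolP; rewrite mulVg; apply: N1.
  by apply/idP/idP; apply: sym.
move=> /asboolP xy /asboolP yz; apply/asboolP.
by have := NM xy yz; rewrite mulgA mulgK.
Qed.

Canonical coset_rel_equiv_rel := EquivRelPack coset_rel_equiv.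

Definition quotient_ncl := {eq_quot coset_rel}.

HB.instance Definition _ := Choice.on quotient_ncl.
HB.instance Definition _ := EqQuotient.on quotient_ncl.

Lemma quotient_ncl_eqP x y :
  reflect (normal_closure A (x^-1 * y))
          (\pi_quotient_ncl x == \pi_quotient_ncl y).
Proof. by rewrite piE; apply: asboolP. Qed.

Definition qncl_one : quotient_ncl := \pi_quotient_ncl 1.
Definition qncl_mul (a b : quotient_ncl) : quotient_ncl :=
  \pi_quotient_ncl (repr a * repr b).
Definition qncl_inv (a : quotient_ncl) : quotient_ncl := \pi_quotient_ncl (repr a)^-1.

Lemma repr_qncl x : N ((repr (\pi_quotient_ncl x))^-1 * x).
Proof. by apply/quotient_ncl_eqP; rewrite reprK. Qed.

Lemma quotient_nclP (a : quotient_ncl) : exists x, a = \pi_quotient_ncl x.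
Proof. by exists (repr a); rewrite reprK. Qed.

Lemma qncl_mulE x y :
  qncl_mul (\pi_quotient_ncl x) (\pi_quotient_ncl y) = \pi_quotient_ncl (x * y).
Proof.
apply/eqP/quotient_ncl_eqP.
set a := repr _; set b := repr _.
have -> : (a * b)^-1 * (x * y) = (a^-1 * x) ^ b * (b^-1 * y).
  by rewrite conjgE invgM !mulgA mulgK.
exact: NM (NJ _ (repr_qncl x)) (repr_qncl y).
Qed.

Lemma qncl_invE x : qncl_inv (\pi_quotient_ncl x) = \pi_quotient_ncl x^-1.
Proof.
apply/eqP/quotient_ncl_eqP; set a := repr _.
have -> : a^-1^-1 * x^-1 = ((a^-1 * x)^-1) ^ a^-1.
  by rewrite conjgE invgM !invgK !mulgA mulgK.
exact: NJ (NV (repr_qncl x)).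
Qed.

Lemma qncl_mulA : associative qncl_mul.
Proof.
move=> a b c; have [x ->] := quotient_nclP a; have [y ->] := quotient_nclP b.
by have [z ->] := quotient_nclP c; rewrite !qncl_mulE mulgA.
Qed.

Lemma qncl_mul1 : left_id qncl_one qncl_mul.
Proof. by move=> a; have [x ->] := quotient_nclP a; rewrite qncl_mulE mul1g. Qed.

Lemma qncl_mulr1 : right_id qncl_one qncl_mul.
Proof. by move=> a; have [x ->] := quotient_nclP a; rewrite qncl_mulE mulg1. Qed.

Lemma qncl_mulV : left_inverse qncl_one qncl_inv qncl_mul.
Proof. by move=> a; have [x ->] := quotient_nclP a; rewrite qncl_invE qncl_mulE mulVg. Qed.

Lemma qncl_mulrV : right_inverse qncl_one qncl_inv qncl_mul.
Proof. by move=> a; have [x ->] := quotient_nclP a; rewrite qncl_invE qncl_mulE mulgV. Qed.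

HB.instance Definition _ :=
  isGroup.Build quotient_ncl qncl_mulA qncl_mul1 qncl_mulr1 qncl_mulV qncl_mulrV.

End QuotientByNormalClosure.

Section TensorSquare.
Variable G : groupType.

Let gen (g h : G) : free_group (G * G)%type := free_gen (g, h).

(* The library's x ^ y on a groupType is y^-1 * (x * y). *)
Definition tensor_relators : set (free_group (G * G)%type) :=
  [set r | exists g g1 h : G,
     r = gen (g * g1) h / (gen (g ^ g1) (h ^ g1) * gen g1 h)] `|`
  [set r | exists g h h1 : G,
     r = gen g (h * h1) / (gen g h1 * gen (g ^ h1) (h ^ h1))].

Definition tensor_square := quotient_ncl tensor_relators.

HB.instance Definition _ := Group.on tensor_square.

Definition tensor (g h : G) : tensor_square :=
  \pi_(quotient_ncl tensor_relators) (gen g h).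

Lemma tensor_mull (g g1 h : G) :
  tensor (g * g1) h = tensor (g ^ g1) (h ^ g1) * tensor g1 h.
Proof.
rewrite /tensor -[RHS]/(qncl_mul _ _) qncl_mulE.
apply/esym/eqP/quotient_ncl_eqP.
set p := (X in X^-1 * _); set q := (X in _ * X).
have -> : p^-1 * q = (q / p) ^ p by rewrite conjgE divgK.
case: (normal_closure_normal tensor_relators) => _ _ _; apply.
by apply: sub_gen_smallest; left; exists g, g1, h.
Qed.

Lemma tensor_mulr (g h h1 : G) :
  tensor g (h * h1) = tensor g h1 * tensor (g ^ h1) (h ^ h1).
Proof.
rewrite /tensor -[RHS]/(qncl_mul _ _) qncl_mulE.
apply/esym/eqP/quotient_ncl_eqP.
set p := (X in X^-1 * _); set q := (X in _ * X).
have -> : p^-1 * q = (q / p) ^ p by rewrite conjgE divgK.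
case: (normal_closure_normal tensor_relators) => _ _ _; apply.
by apply: sub_gen_smallest; right; exists g, h, h1.
Qed.

Definition exterior_square := quotient_ncl (range (fun g : G => tensor g g)).

HB.instance Definition _ := Group.on exterior_square.

End TensorSquare.

Section MatrixGroups.
Import GRing.Theory.
Local Open Scope ring_scope.
Variable n : nat.

Definition GL (R : comUnitRingType) := {A : 'M[R]_n | A \in unitmx}.
Definition SL (R : comUnitRingType) := {A : 'M[R]_n | \det A == 1}.

HB.instance Definition _ (R : comUnitRingType) := Choice.on (GL R).
HB.instance Definition _ (R : comUnitRingType) := Choice.on (SL R).

Section GL.
Variable R : comUnitRingType.
Implicit Types A B : GL R.

Definition GL_one : GL R := exist _ 1%:M (unitmx1 R n).

Lemma GL_mul_subproof A B : val A *m val B \in unitmx.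
Proof. by rewrite unitmx_mul (valP A) (valP B). Qed.
Definition GL_mul A B : GL R :=
  exist _ (val A *m val B) (GL_mul_subproof A B).

Lemma GL_inv_subproof A : invmx (val A) \in unitmx.
Proof. by rewrite unitmx_inv (valP A). Qed.
Definition GL_inv A : GL R := exist _ (invmx (val A)) (GL_inv_subproof A).

Lemma GL_mulA : associative GL_mul.
Proof. by move=> A B C; apply/val_inj/mulmxA. Qed.
Lemma GL_mul1 : left_id GL_one GL_mul.
Proof. by move=> A; apply/val_inj/mul1mx. Qed.
Lemma GL_mulr1 : right_id GL_one GL_mul.
Proof. by move=> A; apply/val_inj/mulmx1. Qed.
Lemma GL_mulV : left_inverse GL_one GL_inv GL_mul.
Proof. by move=> A; apply/val_inj/mulVmx/(valP A). Qed.
Lemma GL_mulrV : right_inverse GL_one GL_inv GL_mul.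
Proof. by move=> A; apply/val_inj/mulmxV/(valP A). Qed.

HB.instance Definition _ :=
  isGroup.Build (GL R) GL_mulA GL_mul1 GL_mulr1 GL_mulV GL_mulrV.
End GL.

Section SL.
Variable R : comUnitRingType.
Implicit Types A B : SL R.

Lemma SL_unitmx A : val A \in unitmx.
Proof. by rewrite unitmxE (eqP (valP A)) unitr1. Qed.

Lemma SL_one_subproof : \det (1%:M : 'M[R]_n) == 1.
Proof. by rewrite det1. Qed.
Definition SL_one : SL R := exist _ 1%:M SL_one_subproof.

Lemma SL_mul_subproof A B : \det (val A *m val B) == 1.
Proof. by rewrite det_mulmx (eqP (valP A)) (eqP (valP B)) mulr1. Qed.
Definition SL_mul A B : SL R :=
  exist _ (val A *m val B) (SL_mul_subproof A B).

Lemma SL_inv_subproof A : \det (invmx (val A)) == 1.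
Proof. by rewrite det_inv (eqP (valP A)) invr1. Qed.
Definition SL_inv A : SL R := exist _ (invmx (val A)) (SL_inv_subproof A).

Lemma SL_mulA : associative SL_mul.
Proof. by move=> A B C; apply/val_inj/mulmxA. Qed.
Lemma SL_mul1 : left_id SL_one SL_mul.
Proof. by move=> A; apply/val_inj/mul1mx. Qed.
Lemma SL_mulr1 : right_id SL_one SL_mul.
Proof. by move=> A; apply/val_inj/mulmx1. Qed.
Lemma SL_mulV : left_inverse SL_one SL_inv SL_mul.
Proof. by move=> A; apply/val_inj/mulVmx/SL_unitmx. Qed.
Lemma SL_mulrV : right_inverse SL_one SL_inv SL_mul.
Proof. by move=> A; apply/val_inj/mulmxV/SL_unitmx. Qed.

HB.instance Definition _ :=
  isGroup.Build (SL R) SL_mulA SL_mul1 SL_mulr1 SL_mulV SL_mulrV.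
End SL.

End MatrixGroups.

Definition has_faithful_rep (G M : groupType) : Prop :=
  exists rho : {multiplicative G -> M}, injective rho.

(* Main.v *)
From HB Require Import structures.
Require Import Defs.
From mathcomp Require Import all_boot all_order all_algebra generic_quotient.
From mathcomp Require Import boolp classical_sets cardinality reals complex.
From mathcomp Require Import ring lra zify.

(** Let [G] be free on [x], write [g @ h] for the generators of the tensor
square [M], and let [d : M -> G] send [g @ h] to the commutator [[~ g, h]].
The proof computes the kernel of [d]; both representations follow from it.

With the diagonal conjugation action of [G] on [M], the pair [(M, d)] is a
crossed module.  Its Peiffer identity ([tensor_peiffer]) makes [ker d] central,
and the identity [d m @ k = m^-1 m^k] ([tensor_comm_l]) makes [G] act trivially
on [ker d].  It contains the elements [x_i @ x_i] and
[(x_i @ x_j)(x_j @ x_i)], and the heart of the proof ([ker_comm_sym]) is that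
it is generated by them.  This goes by induction on a finite list of
generators.  Let [A] be spanned by the generators in the list and let [y] be a
further generator.  The defining relations of [M] say precisely that the
subgroup [S] spanned by all [a @ b], with [a] in [A] and [b] in [<y>], is
stable under [A] and [<y>], and it follows that every product of elements
[g @ h] with [g], [h] in [<A, y>] factors as [s m q], where [s] lies in [S],
[m] is a product of elements [a @ a'] with [a], [a'] in [A], and [q] is a
product of the symmetric elements above ([tensor_span_cons]).  If [d] kills
[s m q], then killing [y] in [G] shows that it kills [m], which is covered by
induction, and then that it kills [s].  Finally [d] is injective on [S]
([mixed_comm_inj]): in a free product [A * B] the commutators [[~ a, b]] satisfy
no relations, which is seen by letting the free product act on [A x B x M] in
such a way that [[~ a, b]] multiplies the last coordinate of a point
[(1, 1, s)] by [a @ b].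

Exterior square: the symmetric elements die in it, so [d] induces an injection
of [G /\ G] into [G] ([exterior_faithful]), and a free group of countable rank
embeds in [SL_2(Z)] by a ping-pong argument ([free_group_SL2]).

Tensor square: a bilinear map on [G] gives a homomorphism from [M] to the
multiplicative group of positive rationals that sends distinct symmetric
elements to distinct primes, hence is injective on [ker d]
([sym_part_detect]).  The representation multiplies the matrix of [d w] in
[SL_2(Z)] by that scalar.  Comparing determinants shows that the product is
the identity only if both factors are ([scaled_rep_inj]). *)

Set Implicit Arguments.
Unset Strict Implicit.
Unset Printing Implicit Defensive.

Local Open Scope quotient_scope.
Local Open Scope group_scope.

Local Notation hom := UMagmaMorphism.type.

(* Proves word identities in a group: both sides are brought to reduced,
   left-associated words. *)
Ltac group := rewrite ?commgEl ?conjgE !(mulgA, mulg1, mul1g, invg1, invgM, invgK,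
  mulgK, mulgVK, mulgV, mulVg) //.

(** * Subgroups, quotients and free bases *)

Section Subgroups.
Variable H : groupType.
Implicit Types P Q : H -> Prop.

Inductive generated P : H -> Prop :=
| generated_in x : P x -> generated P x
| generated1 : generated P 1
| generatedM x y : generated P x -> generated P y -> generated P (x * y)
| generatedV x : generated P x -> generated P x^-1.

Definition subgroup P :=
  [/\ P 1, forall x y, P x -> P y -> P (x * y) & forall x, P x -> P x^-1].

Lemma generated_subgroup P : subgroup (generated P).
Proof.
split=> [|x y|x]; [exact: generated1|exact: generatedM|exact: generatedV].
Qed.

Lemma subgroup1 : subgroup (fun x : H => x = 1).
Proof. by split=> [//|x y -> ->|x ->]; rewrite ?mulg1 ?invg1. Qed.

Lemma generated_sub P Q :
  subgroup Q -> (forall x, P x -> Q x) -> forall x, generated P x -> Q x.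
Proof. by case=> Q1 QM QV PQ x; elim=> {x} *; auto. Qed.

Lemma generated_mono P Q :
  (forall x, P x -> Q x) -> forall x, generated P x -> generated Q x.
Proof.
by move=> PQ; apply: generated_sub (generated_subgroup Q) _ => x /PQ/generated_in.
Qed.

End Subgroups.

Lemma hom_of_morph (G H : groupType) (f : G -> H) :
  {morph f : x y / x * y} -> exists F : hom G H, F =1 f.
Proof.
move=> fM.
have f1 : f 1 = 1 by apply: (@mulIg _ (f 1)); rewrite -fM !mul1g.
pose F : hom G H := HB.pack f (isMultiplicative.Build G H f fM)
                              (Multiplicative_isUMagmaMorphism.Build G H f f1).
by exists F.
Qed.

Lemma subgroup_preim (G H : groupType) (f : hom G H) (Q : H -> Prop) :
  subgroup Q -> subgroup (fun x => Q (f x)).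
Proof.
case=> Q1 QM QV; split=> [|x y Qx Qy|x Qx]; first by rewrite gmulf1.
  by rewrite gmulfM; apply: QM.
by rewrite gmulfV; apply: QV.
Qed.

Lemma generated_hom (G H : groupType) (f : hom G H) (P : G -> Prop) (Q : H -> Prop) :
  subgroup Q -> (forall x, P x -> Q (f x)) -> forall x, generated P x -> Q (f x).
Proof. by move=> sQ; apply: generated_sub (subgroup_preim f sQ). Qed.

Lemma subgroup_ker (G H : groupType) (f : hom G H) : subgroup (fun x => f x = 1).
Proof. exact: subgroup_preim (subgroup1 H). Qed.

(** The kernel of [f] is one of the normal subgroups whose intersection is the
normal closure of [A]. *)
Lemma quotient_ncl_lift (G H : groupType) (A : set G) (f : hom G H) :
  (forall r, A r -> f r = 1) ->
  exists F : hom (quotient_ncl A) H, forall g, F (\pi_(quotient_ncl A) g) = f g.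
Proof.
move=> fA.
have fN g : normal_closure A g -> f g = 1.
  move=> Ng; apply: (Ng (fun x => f x = 1)); split=> //.
  have [f1 fM fV] := subgroup_ker f; split=> // x y fx.
  by rewrite gmulfJ fx conj1g.
have fpi g : f (repr (\pi_(quotient_ncl A) g)) = f g.
  have /fN := @repr_qncl G A g; rewrite gmulfM gmulfV => /mulg1_eq.
  by rewrite invgK.
have [|F FE] := @hom_of_morph (quotient_ncl A) H (fun q => f (repr q)).
  move=> q r; have [x ->] := quotient_nclP q; have [y ->] := quotient_nclP r.
  have -> : \pi_(quotient_ncl A) x * \pi_(quotient_ncl A) y =
    \pi_(quotient_ncl A) (x * y).
    exact: qncl_mulE.
  by rewrite !fpi gmulfM.
by exists F => g; rewrite FE fpi.
Qed.

(** The universal property of a basis is required for actions on sets rather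
than for maps into groups: [mixed_comm_inj] and [free_basis_inj] use actions
directly, and [free_basis_lift] recovers homomorphisms from left translations. *)
Definition free_basis (T : Type) (G : groupType) (x : T -> G) :=
  (forall g, generated (fun h => exists t, h = x t) g) /\
  forall (X : Type) (f f' : T -> X -> X),
    (forall t, cancel (f t) (f' t)) -> (forall t, cancel (f' t) (f t)) ->
  exists act : G -> X -> X,
    [/\ forall y, act 1 y = y, forall g h y, act (g * h) y = act g (act h y)
      & forall t y, act (x t) y = f t y].

Lemma free_basis_lift (T : Type) (G H : groupType) (x : T -> G) (phi : T -> H) :
  free_basis x -> exists f : hom G H, forall t, f (x t) = phi t.
Proof.
case=> gen_x /(_ H (fun t => *%g (phi t)) (fun t => *%g (phi t)^-1)) [] //.
- by move=> t y; rewrite mulKg.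
- by move=> t y; rewrite mulVKg.
move=> act [act1 actM actx].
have actE g y : act g y = act g 1 * y.
  elim: (gen_x g) y => {g} [_ [t ->]|||] /=.
  - by move=> y; rewrite !actx mulg1.
  - by move=> y; rewrite !act1 mul1g.
  - by move=> g h _ gE _ hE y; rewrite !actM gE hE [act g (act h 1)]gE mulgA.
  - move=> g _ gE y.
    have {1}-> : y = act g (act g^-1 1 * y).
      by rewrite gE mulgA -gE -actM mulgV act1 mul1g.
    by rewrite -actM mulVg act1.
have [|f fE] := @hom_of_morph G H (act^~ 1).
  by move=> g h; rewrite actM actE.
by exists f => t; rewrite fE actx mulg1.
Qed.

Lemma free_gen_basis (T : choiceType) : free_basis (@free_gen T).
Proof.
split=> [g|X f f' fK f'K].
  have [s ->] := free_groupP g; elim: s => [|[t b] s IHs]; first exact: generated1.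
  have -> : \pi_(free_group T) ((t, b) :: s) =
      \pi_(free_group T) [:: (t, b)] * \pi_(free_group T) s.
    by rewrite -[RHS]/(free_mul _ _) free_mulE.
  apply: generatedM => //; case: b.
    have -> : \pi_(free_group T) [:: (t, true)] = (free_gen t)^-1.
      by rewrite -[RHS]/(free_inv _) free_invE.
    by apply/generatedV/generated_in; exists t.
  by apply/generated_in; exists t.
pose op (l : T * bool) := if l.2 then f' l.1 else f l.1.
pose ev s y := foldr op y s.
have evE s s' : word_equiv s s' -> forall y, ev s y = ev s' y.
  elim=> {s s'} [//|s s' _ E y|s s' s'' _ E _ E' y|s s' t b y].
  - by rewrite E.
  - by rewrite E E'.
  - by rewrite /ev !foldr_cat /op /=; case: b; rewrite ?fK ?f'K.
exists (fun g => ev (repr g)); split=> [y|g h y|t y].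
- exact: (evE _ [::] (repr_free _)).
- rewrite (evE _ (repr g ++ repr h)) ?/ev ?foldr_cat //; exact: repr_free.
- exact: (evE _ [:: (t, false)] (repr_free _)).
Qed.

Lemma free_basis_iso (T : Type) (F G : groupType) (x : T -> F) (f : hom F G) :
  bijective f -> free_basis x -> free_basis (f \o x).
Proof.
case=> f' fK f'K [gen_x act_x]; split=> [g|X e e' eK e'K].
  rewrite -(f'K g).
  apply: (@generated_hom _ _ f _ _ (generated_subgroup _)) (gen_x (f' g)).
  by move=> _ [t ->]; apply: generated_in; exists t.
have [act [act1 actM actx]] := act_x X e e' eK e'K.
have f'M := can2_gmulfM fK f'K.
exists (fun g => act (f' g)); split=> [y|g h y|t y].
- by rewrite (can2_gmulf1 fK f'K) act1.
- by rewrite f'M actM.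
- by rewrite /= fK actx.
Qed.

Lemma free_basis_inj (T : eqType) (G : groupType) (x : T -> G) :
  free_basis x -> injective x.
Proof.
move=> basis_x i j xij.
(* An action on the booleans in which only the letter [i] moves anything. *)
pose flip k b := (k == i) (+) b.
have flipK k : cancel (flip k) (flip k) by move=> b; rewrite /flip addKb.
have [act [_ _ actx]] := basis_x.2 _ flip flip flipK flipK.
have := actx j false; rewrite -xij actx /flip eqxx !addbF.
by move/esym/eqP.
Qed.

Section FreeProduct.
Variables (T : Type) (G M : groupType) (x : T -> G) (P : pred T).
Variables (u : G -> G -> M) (d : hom M G).
Hypothesis basis_x : free_basis x.
Hypothesis u1g : forall g, u 1 g = 1.
Hypothesis ug1 : forall g, u g 1 = 1.
Hypothesis d_u : forall g h, d (u g h) = [~ g, h].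

Let A := generated (fun g => exists2 t, P t & g = x t).
Let B := generated (fun g => exists2 t, ~~ P t & g = x t).

(** The group [G] is the free product of [A] and [B].  It acts on
triples in two charts: a point [(a, b, s)] stands for the formal product
[b a s], and [a b s'] with [s = u a b * s'] denotes the same point.  Letters of
[B] translate [b] in the first chart, letters of [A] translate [a] in the
second one.  In the coordinates used below, which are those of the second
chart, a commutator [[~ a, b]] then sends [(1, 1, s)] to [(1, 1, u a b * s)],
so an element of the span of the [u a b] is recovered from its image under
[d]. *)
Lemma mixed_comm_inj w :
  generated (fun m => exists a b, [/\ A a, B b & m = u a b]) w -> d w = 1 -> w = 1.
Proof.
pose shift a b b' := (u a b')^-1 * u a b.
pose f t (y : G * G * M) := let: (a, b, s) := y in
  if P t then (x t * a, b, s) else (a, x t * b, shift a b (x t * b) * s).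
pose f' t (y : G * G * M) := let: (a, b, s) := y in
  if P t then ((x t)^-1 * a, b, s)
  else (a, (x t)^-1 * b, shift a b ((x t)^-1 * b) * s).
have [] := basis_x.2 _ f f'.
- move=> t [[a b] s]; rewrite /f /f' /shift; case: (P t); rewrite ?mulKg //.
  by congr (_, _, _); group.
- move=> t [[a b] s]; rewrite /f /f' /shift; case: (P t); rewrite ?mulVKg //.
  by congr (_, _, _); group.
move=> act [act1 actM actx].
have actV g y z : act g y = z -> act g^-1 z = y.
  by move=> <-; rewrite -actM mulVg act1.
have actA a : A a -> forall a' b s, act a (a', b, s) = (a * a', b, s).
  elim=> {a} [_ [t Pt ->]||g h _ gE _ hE|g _ gE] a' b s.
  - by rewrite actx /f Pt.
  - by rewrite act1 mul1g.
  - by rewrite actM hE gE mulgA.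
  - by apply: actV; rewrite gE mulVKg.
have actB b : B b -> forall a b' s,
    act b (a, b', s) = (a, b * b', shift a b' (b * b') * s).
  elim=> {b} [_ [t Pt ->]||g h _ gE _ hE|g _ gE] a b s.
  - by rewrite actx /f (negbTE Pt).
  - by rewrite act1 mul1g /shift mulVg mul1g.
  - by rewrite actM hE gE /shift; congr (_, _, _); group.
  - by apply: actV; rewrite gE /shift; congr (_, _, _); group.
have actS w' : generated (fun m => exists a b, [/\ A a, B b & m = u a b]) w' ->
    forall s, act (d w') (1, 1, s) = (1, 1, w' * s).
  elim=> {w'} [_ [a [b [Aa Bb ->]]]||w1 w2 _ E1 _ E2|w1 _ E1] s.
  - rewrite d_u commgEl conjgE !actM (actB b) // !mulg1 (actA a) // mulg1 /shift !u1g.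
    rewrite (actB b^-1); last exact: generatedV.
    rewrite (actA a^-1); last exact: generatedV.
    by rewrite !mulVg /shift ug1; group.
  - by rewrite gmulf1 act1 mul1g.
  - by rewrite gmulfM actM E2 E1 mulgA.
  - by rewrite gmulfV; apply: actV; rewrite E1 mulVKg.
move=> Sw dw; have := actS _ Sw 1; rewrite dw act1 mulg1.
by case.
Qed.

End FreeProduct.

(** * Tensor squares and their crossed module *)

Definition crossed (G H : groupType) (u : G -> G -> H) :=
  (forall g k h, u (g * k) h = u (g ^ k) (h ^ k) * u k h) /\
  (forall g h k, u g (h * k) = u g k * u (g ^ k) (h ^ k)).

(** The tensor square is used below only through this property, which keeps its
construction by words and cosets out of the computations. *)
Definition universal_crossed (G M : groupType) (t : G -> G -> M) :=
  [/\ crossed t,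
      forall w, generated (fun m => exists g h, m = t g h) w
    & forall (H : groupType) (u : G -> G -> H), crossed u ->
      exists f : hom M H, forall g h, f (t g h) = u g h].

Section TensorSquare.
Variable G : groupType.
Local Notation M := (tensor_square G).
Implicit Types (g h k a b : G) (m w : M).

Lemma tensor_generated w : generated (fun m => exists g h, m = tensor g h) w.
Proof.
have [y ->] := quotient_nclP w.
elim: ((@free_gen_basis (G * G)%type).1 y) => {y} [_ [[g h] ->]||y z _ IHy _ IHz|y _ IHy].
- by apply: generated_in; exists g, h.
- exact: generated1.
- have -> : \pi_(quotient_ncl (@tensor_relators G)) (y * z) =
      (\pi_(quotient_ncl _) y : M) * (\pi_(quotient_ncl _) z : M).
    by symmetry; exact: qncl_mulE.
  exact: generatedM.
- have -> : \pi_(quotient_ncl (@tensor_relators G)) y^-1 =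
      (\pi_(quotient_ncl _) y : M)^-1.
    by symmetry; exact: qncl_invE.
  exact: generatedV.
Qed.

Lemma tensor_lift (H : groupType) (u : G -> G -> H) :
  crossed u ->
  exists f : hom M H, forall g h, f (tensor g h) = u g h.
Proof.
move=> [ul ur].
have [f fE] := free_basis_lift (fun p => u p.1 p.2) (@free_gen_basis (G * G)%type).
have [|F FE] := @quotient_ncl_lift _ H (@tensor_relators G) f.
  move=> _ [[g [k [h ->]]]|[g [h [k ->]]]]; rewrite gmulfF gmulfM !fE /=.
    by rewrite ul mulgV.
  by rewrite ur mulgV.
have [|F' F'E] := @hom_of_morph M H F; first by move=> p q; exact: gmulfM.
exists F' => g h; rewrite F'E -[RHS](fE (g, h)); exact: FE.
Qed.

Lemma tensor_universal : universal_crossed (@tensor G).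
Proof.
split; [by split; [exact: tensor_mull|exact: tensor_mulr]|exact: tensor_generated|].
exact: tensor_lift.
Qed.

End TensorSquare.

Section UniversalCrossed.
Variables (G M : groupType) (t : G -> G -> M).
Hypothesis t_univ : universal_crossed t.
Implicit Types (g h k a b : G) (m w : M).

Let tMl g k h : t (g * k) h = t (g ^ k) (h ^ k) * t k h.
Proof. by have [[tl _] _ _] := t_univ; apply: tl. Qed.
Let tMr g h k : t g (h * k) = t g k * t (g ^ k) (h ^ k).
Proof. by have [[_ tr] _ _] := t_univ; apply: tr. Qed.
Let t_gen w : generated (fun m => exists g h, m = t g h) w.
Proof. by have [_ tg _] := t_univ; apply: tg. Qed.
Let t_lift (H : groupType) (u : G -> G -> H) :
  crossed u -> exists f : hom M H, forall g h, f (t g h) = u g h.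
Proof. by have [_ _ tlift] := t_univ; apply: tlift. Qed.

Lemma tensor_comm_subproof :
  exists f : hom M G, forall g h, f (t g h) = [~ g, h].
Proof. by apply: t_lift; split=> *; group. Qed.
Definition tensor_comm := projT1 (cid tensor_comm_subproof).
Lemma tensor_commE g h : tensor_comm (t g h) = [~ g, h].
Proof. exact: (projT2 (cid tensor_comm_subproof)). Qed.

(** Diagonal conjugation, [g @ h] to [g ^ k @ h ^ k], is the action of [G] that
makes the commutator map a crossed module. *)
Lemma tensor_conj_subproof k :
  exists f : hom M M, forall g h, f (t g h) = t (g ^ k) (h ^ k).
Proof.
apply: t_lift; split=> [g l h|g h l].
  by rewrite conjMg tMl -(conjJg g) -(conjJg h).
by rewrite conjMg tMr -(conjJg g) -(conjJg h).
Qed.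
Definition tensor_conj k := projT1 (cid (tensor_conj_subproof k)).
Lemma tensor_conjE k g h : tensor_conj k (t g h) = t (g ^ k) (h ^ k).
Proof. exact: (projT2 (cid (tensor_conj_subproof k))). Qed.

Lemma tensor_conj1 m : tensor_conj 1 m = m.
Proof.
elim: (t_gen m) => {m} [_ [g [h ->]]||m w _ IHm _ IHw|m _ IHm].
- by rewrite tensor_conjE !conjg1.
- exact: gmulf1.
- by rewrite gmulfM IHm IHw.
- by rewrite gmulfV IHm.
Qed.

Lemma tensor_conjM k l m : tensor_conj (k * l) m = tensor_conj l (tensor_conj k m).
Proof.
elim: (t_gen m) => {m} [_ [g [h ->]]||m w _ IHm _ IHw|m _ IHm].
- by rewrite !tensor_conjE !conjgM.
- by rewrite !gmulf1.
- by rewrite !gmulfM IHm IHw.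
- by rewrite !gmulfV IHm.
Qed.

Lemma tensor1g g : t 1 g = 1.
Proof.
have := tMl 1 1 g; rewrite mulg1 !conjg1 => E.
by apply: (@mulgI _ (t 1 g)); rewrite -E mulg1.
Qed.

Lemma tensorg1 g : t g 1 = 1.
Proof.
have := tMr g 1 1; rewrite mulg1 !conjg1 => E.
by apply: (@mulgI _ (t g 1)); rewrite -E mulg1.
Qed.

(** With [tensor_conj] the defining relations read as a left and a right
derivation rule. *)
Lemma tensor_Ml g k h : t (g * k) h = tensor_conj k (t g h) * t k h.
Proof. by rewrite tensor_conjE tMl. Qed.

Lemma tensor_Mr g h k : t g (h * k) = t g k * tensor_conj k (t g h).
Proof. by rewrite tensor_conjE tMr. Qed.

Lemma tensor_Vl g h : t g^-1 h = (tensor_conj g^-1 (t g h))^-1.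
Proof.
by apply/esym/mulg1_eq; rewrite -tensor_Ml mulgV tensor1g.
Qed.

Lemma tensor_Vr g h : t g h^-1 = (tensor_conj h^-1 (t g h))^-1.
Proof.
apply/esym/mulg1_eq; have := tensor_Mr g h h^-1; rewrite mulgV tensorg1.
by move/esym/mulg1_eq <-; rewrite mulVg.
Qed.

(** Expanding [g a @ h b] in either variable first gives two words with the same
ends; comparing their middles shows that the two ways of conjugating agree. *)
Lemma tensor_peiffer_gen g h a b :
  tensor_conj [~ a, b] (t g h) = t g h ^ t a b.
Proof.
suff E k : tensor_conj (b * a * [~ a, b]) (t (g ^ k) (h ^ k)) =
           tensor_conj (b * a) (t (g ^ k) (h ^ k)) ^ t a b.
  have := E (b * a)^-1; rewrite -tensor_conjE -!tensor_conjM mulKg.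
  by rewrite mulVg tensor_conj1.
rewrite -commgC; move: (g ^ k) (h ^ k) => {k} {}g {}h.
have := tensor_Ml g a (h * b); rewrite !tensor_Mr tensor_Ml.
rewrite [t (g * a) h]tensor_Ml !gmulfM -!tensor_conjM -!mulgA => /mulgI.
rewrite !mulgA => /mulIg E.
by rewrite conjgE -E mulKg.
Qed.

(** The Peiffer identity of the crossed module: an element acts on the tensor
square by conjugation as its image in [G] does. *)
Lemma tensor_peiffer m w : tensor_conj (tensor_comm w) m = m ^ w.
Proof.
elim: (t_gen w) m => {w} [_ [a [b ->]]||v w _ IHv _ IHw|w _ IHw] m.
- rewrite tensor_commE.
  elim: (t_gen m) => {m} [_ [g [h ->]]||m w _ IHm _ IHw|m _ IHm].
  + exact: tensor_peiffer_gen.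
  + by rewrite gmulf1 conj1g.
  + by rewrite gmulfM IHm IHw conjMg.
  + by rewrite gmulfV IHm conjVg.
- by rewrite gmulf1 tensor_conj1 conjg1.
- by rewrite gmulfM tensor_conjM IHv IHw conjgM.
- rewrite gmulfV -{1}[m](conjgKV w) -IHw -tensor_conjM mulgV.
  by rewrite tensor_conj1.
Qed.

(** Besides the Peiffer identity this carries all that is needed of the crossed
module: it makes the action of [G] on the kernel trivial, and it shows that an
element moves by a tensor when [k] acts on it. *)
Lemma tensor_comm_l m k : t (tensor_comm m) k = m^-1 * tensor_conj k m.
Proof.
elim: (t_gen m) => {m} [_ [g [h ->]]||m w _ IHm _ IHw|m _ IHm].
- rewrite tensor_commE commgEl tensor_Ml tensor_Vl gmulfV -tensor_conjM.
  rewrite -commgEl tensor_peiffer_gen.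
  have E : t g h * t (g ^ h) k = t g k * tensor_conj k (t g h).
    rewrite -tensor_Mr; have -> : h * k = k ^ h^-1 * h by group.
    by rewrite tMr conjgKV.
  by rewrite -[tensor_conj k _](mulKg (t g k)) -E; group.
- by rewrite !gmulf1 tensor1g mulg1 invg1.
- rewrite gmulfM tensor_Ml IHm IHw tensor_peiffer gmulfM; group.
- rewrite gmulfV tensor_Vl IHm -[(tensor_comm m)^-1]gmulfV tensor_peiffer gmulfV; group.
Qed.

End UniversalCrossed.

(** * The kernel of the commutator map for a free group *)

Section Kernel.
Variables (T : eqType) (G M : groupType) (x : T -> G) (t : G -> G -> M).
Hypothesis basis_x : free_basis x.
Hypothesis t_univ : universal_crossed t.
Local Notation d := (tensor_comm t_univ).
Local Notation conj := (tensor_conj t_univ).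
Implicit Types (i j : T) (l : seq T) (g h k a b : G) (m w s q : M).

Lemma ker_comm_central w m : d w = 1 -> commute w m.
Proof.
move=> dw; have := tensor_peiffer t_univ m w; rewrite dw tensor_conj1.
by move=> mw; rewrite /commute [RHS]conjgC -mw.
Qed.

Lemma ker_comm_fixed w k : d w = 1 -> conj k w = w.
Proof.
move=> dw; have := tensor_comm_l t_univ w k.
by rewrite dw (tensor1g t_univ) => /esym/mulg1_eq; rewrite invgK.
Qed.

(** In the tensor square over [Z] of the abelianisation of [G] these elements
become the standard basis of the symmetric tensors; the diagonal is treated
apart because the symmetrisation of [x_i @ x_i] is twice a basis vector. *)
Definition sym_tensor i j :=
  if i == j then t (x i) (x i) else t (x i) (x j) * t (x j) (x i).

Definition sym_part := generated (fun m => exists i j, m = sym_tensor i j).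

Lemma sym_part_ker w : sym_part w -> d w = 1.
Proof.
move: w; apply: generated_sub (subgroup_ker d) _ => _ [i [j ->]].
rewrite /sym_tensor; case: eqP => _; rewrite ?gmulfM !tensor_commE ?commgg //.
by rewrite -(invgR (x j)) mulVg.
Qed.

(** A central product does not depend on the order of its two factors. *)
Lemma sym_tensorC i j : sym_tensor i j = sym_tensor j i.
Proof.
rewrite /sym_tensor eq_sym; case: eqP => [-> //|ij].
have : commute (sym_tensor i j) (t (x i) (x j)).
  by apply/ker_comm_central/sym_part_ker/generated_in; exists i, j.
rewrite /sym_tensor; case: eqP => [ji|_]; first by rewrite ji in ij.
by rewrite /commute -mulgA => /mulgI.
Qed.

(** The derivation rules expand a tensor of words into conjugates of tensors of
letters. *)
Lemma generated_crossed (X : G -> Prop) (V : M -> Prop) : subgroup V ->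
  (forall y v, X y -> V v -> V (conj y v) /\ V (conj y^-1 v)) ->
  (forall y z, X y -> X z -> V (t y z)) ->
  forall g h, generated X g -> generated X h -> V (t g h).
Proof.
move=> [V1 VM VV] Vconj VX g h Xg Xh.
have conjX k : generated X k -> forall v, V v -> V (conj k v) /\ V (conj k^-1 v).
  elim=> {k} [y Xy v Vv||k l _ IHk _ IHl v Vv|k _ IHk v Vv].
  - exact: Vconj.
  - by move=> v Vv; rewrite invg1 tensor_conj1.
  - rewrite invgM !tensor_conjM; split.
      by apply: (IHl _ _).1; apply: (IHk _ _).1.
    by apply: (IHk _ _).2; apply: (IHl _ _).2.
  - by rewrite invgK; have [] := IHk _ Vv.
have VXh y : X y -> V (t y h).
  move=> Xy; elim: Xh => {h} [z Xz||h k _ IHh Xk IHk|h Xh IHh].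
  - exact: VX.
  - by rewrite (tensorg1 t_univ).
  - by rewrite (tensor_Mr t_univ); apply: VM => //; apply: (conjX _ _ _ _).1.
  - by rewrite (tensor_Vr t_univ); apply/VV/(conjX _ _ _ _).2.
elim: Xg => {g} [y Xy||g k _ IHg Xk IHk|g Xg IHg].
- exact: VXh.
- by rewrite (tensor1g t_univ).
- by rewrite (tensor_Ml t_univ); apply: VM => //; apply: (conjX _ _ _ _).1.
- by rewrite (tensor_Vl t_univ); apply/VV/(conjX _ _ _ _).2.
Qed.

Definition letter_span l := generated (fun g => exists2 i, i \in l & g = x i).

Definition tensor_span l :=
  generated (fun m => exists g h, [/\ letter_span l g, letter_span l h & m = t g h]).

Lemma letter_spanR l g h :
  letter_span l g -> letter_span l h -> letter_span l [~ g, h].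
Proof.
move=> lg lh; rewrite commgEl conjgE.
do ![apply: generatedM => //]; exact: generatedV.
Qed.

Lemma letter_spanJ l g h :
  letter_span l g -> letter_span l h -> letter_span l (g ^ h).
Proof.
move=> lg lh; rewrite conjgE; do ![apply: generatedM => //]; exact: generatedV.
Qed.

Lemma letter_span_mono l l' :
  {subset l <= l'} -> forall g, letter_span l g -> letter_span l' g.
Proof. by move=> ll'; apply: generated_mono => _ [i /ll' ? ->]; exists i. Qed.

Lemma tensor_span_mono l l' :
  {subset l <= l'} -> forall w, tensor_span l w -> tensor_span l' w.
Proof.
move=> ll'; apply: generated_mono => _ [g [h [lg lh ->]]].
by exists g, h; split=> //; apply: letter_span_mono ll' _ _.
Qed.

Lemma letter_span_ex g : exists l, letter_span l g.
Proof.
elim: (basis_x.1 g) => {g} [_ [i ->]||g h _ [l lg] _ [l' lh]|g _ [l lg]].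
- by exists [:: i]; apply: generated_in; exists i; rewrite ?inE.
- by exists [::]; apply: generated1.
- exists (l ++ l'); apply: generatedM.
    by apply: letter_span_mono lg => i; rewrite mem_cat => ->.
  by apply: letter_span_mono lh => i; rewrite mem_cat => ->; rewrite orbT.
- by exists l; apply: generatedV.
Qed.

Lemma tensor_span_ex w : exists l, tensor_span l w.
Proof.
have [_ /(_ w) t_gen _] := t_univ.
elim: t_gen => {w} [_ [g [h ->]]||m w _ [l lm] _ [l' lw]|w _ [l lw]].
- have [l lg] := letter_span_ex g; have [l' lh] := letter_span_ex h; exists (l ++ l').
  apply: generated_in; exists g, h; split=> //.
    by apply: letter_span_mono lg => i; rewrite mem_cat => ->.
  by apply: letter_span_mono lh => i; rewrite mem_cat => ->; rewrite orbT.
- by exists [::]; apply: generated1.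
- exists (l ++ l'); apply: generatedM.
    by apply: tensor_span_mono lm => i; rewrite mem_cat => ->.
  by apply: tensor_span_mono lw => i; rewrite mem_cat => ->; rewrite orbT.
- by exists l; apply: generatedV.
Qed.

Lemma comm_tensor_span l w : tensor_span l w -> letter_span l (d w).
Proof.
move: w.
apply: (@generated_hom _ _ d _ (letter_span l) (generated_subgroup _))
  => _ [g [h [lg lh ->]]].
by rewrite tensor_commE; apply: letter_spanR.
Qed.

Lemma conj_tensor_span l a w :
  letter_span l a -> tensor_span l w -> tensor_span l (conj a w).
Proof.
move=> la; move: w.
apply: (@generated_hom _ _ (conj a) _ (tensor_span l) (generated_subgroup _))
  => _ [g [h [lg lh ->]]].
rewrite tensor_conjE; apply: generated_in.
by exists (g ^ a), (h ^ a); split=> //; apply: letter_spanJ.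
Qed.

Definition mixed_span l j :=
  generated (fun m => exists a b, [/\ letter_span l a, letter_span [:: j] b & m = t a b]).

Lemma mixed_span_in l j a b :
  letter_span l a -> letter_span [:: j] b -> mixed_span l j (t a b).
Proof. by move=> la jb; apply: generated_in; exists a, b. Qed.

(** The next two lemmas are the defining relations of the tensor square read
backwards: they say how the two free factors act on the mixed tensors. *)
Lemma conj_mixed_span_l l j a s :
  letter_span l a -> mixed_span l j s -> mixed_span l j (conj a s).
Proof.
move=> la; move: s.
apply: (@generated_hom _ _ (conj a) _ (mixed_span l j) (generated_subgroup _))
  => _ [a' [b [la' jb ->]]].
have -> : conj a (t a' b) = t (a' * a) b * (t a b)^-1.
  by rewrite (tensor_Ml t_univ) mulgK.
apply: generatedM; last apply: generatedV; apply: mixed_span_in => //.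
exact: generatedM.
Qed.

Lemma conj_mixed_span_r l j b s :
  letter_span [:: j] b -> mixed_span l j s -> mixed_span l j (conj b s).
Proof.
move=> jb; move: s.
apply: (@generated_hom _ _ (conj b) _ (mixed_span l j) (generated_subgroup _))
  => _ [a [b' [la jb' ->]]].
have -> : conj b (t a b') = (t a b)^-1 * t a (b' * b).
  by rewrite (tensor_Mr t_univ) mulKg.
apply: generatedM; first apply: generatedV; apply: mixed_span_in => //.
exact: generatedM.
Qed.

(** The products [s m q] form a subgroup that is stable under all letters of
[j :: l], so [generated_crossed] applies.  Letters of [l] preserve each factor,
and [x j] moves [m] by the element [d m @ x j] of the first factor.  The one
pair of letters that is not visibly covered is [(x j, x i)] with [i] in [l]; it
differs from the inverse of [x i @ x j] by a symmetric element. *)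
Lemma tensor_span_cons l j w : tensor_span (j :: l) w ->
  exists s m q, [/\ mixed_span l j s, tensor_span l m, sym_part q & w = s * m * q].
Proof.
pose V w := exists s m q,
  [/\ mixed_span l j s, tensor_span l m, sym_part q & w = s * m * q].
have V_mixed s : mixed_span l j s -> V s.
  by exists s, 1, 1; split; rewrite ?mulg1 //; apply: generated1.
have V_tensor m : tensor_span l m -> V m.
  by exists 1, m, 1; split; rewrite ?mul1g ?mulg1 //; apply: generated1.
have V_sym q : sym_part q -> V q.
  by exists 1, 1, q; split; rewrite ?mul1g ?mulg1 //; apply: generated1.
have mixedJ s m : mixed_span l j s -> tensor_span l m -> mixed_span l j (s ^ m).
  move=> ls lm; rewrite -(tensor_peiffer t_univ); apply: conj_mixed_span_l => //.
  exact: comm_tensor_span.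
have V_subgroup : subgroup V.
  split=> [|_ _ [s [m [q [ls lm Qq ->]]]] [s' [m' [q' [ls' lm' Qq' ->]]]]
           |_ [s [m [q [ls lm Qq ->]]]]].
  - exact/V_sym/generated1.
  - exists (s * s' ^ m^-1), (m * m'), (q * q').
    split; try by apply: generatedM => //; apply: mixedJ => //; apply: generatedV.
    have qC n : q * n = n * q by apply/ker_comm_central/sym_part_ker.
    by rewrite -mulgA [q * (_ * q')]mulgA (qC (s' * m')); group.
  - exists (s^-1 ^ m), m^-1, q^-1.
    split; rewrite ?conjVg; try by apply: generatedV => //; apply: mixedJ.
    have qC n : n * q^-1 = q^-1 * n.
      by apply/esym/ker_comm_central; rewrite gmulfV (sym_part_ker Qq) invg1.
    by rewrite qC; group.
have V_conj_l a v : letter_span l a -> V v -> V (conj a v).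
  move=> la [s [m [q [ls lm Qq ->]]]]; exists (conj a s), (conj a m), q; split=> //.
  - exact: conj_mixed_span_l.
  - exact: conj_tensor_span.
  - by rewrite !gmulfM (ker_comm_fixed _ (sym_part_ker Qq)).
have V_conj_r b v : letter_span [:: j] b -> V v -> V (conj b v).
  move=> jb [s [m [q [ls lm Qq ->]]]].
  exists (conj b s * t (d m) b ^ m^-1), m, q; split=> //.
    apply: generatedM; first exact: conj_mixed_span_r.
    apply: mixedJ; last exact: generatedV.
    by apply: mixed_span_in => //; apply: comm_tensor_span.
  rewrite !gmulfM (ker_comm_fixed _ (sym_part_ker Qq)).
  by rewrite (tensor_comm_l t_univ); group.
move: w; apply: (generated_sub V_subgroup) => _ [g [h [lg lh ->]]].
apply: (generated_crossed V_subgroup _ _ lg lh).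
  move=> _ v [i + ->] Vv; rewrite inE => /predU1P[->|li].
    have jx : letter_span [:: j] (x j) by apply: generated_in; exists j; rewrite ?inE.
    by split; apply: V_conj_r => //; apply: generatedV.
  have lx : letter_span l (x i) by apply: generated_in; exists i.
  by split; apply: V_conj_l => //; apply: generatedV.
have jx : letter_span [:: j] (x j) by apply: generated_in; exists j; rewrite ?inE.
have lx i : i \in l -> letter_span l (x i) by move=> li; apply: generated_in; exists i.
have Vsym i i' : V (sym_tensor i i').
  by apply/V_sym/generated_in; exists i, i'.
have [V1 VM VV] := V_subgroup.
have V_lj i : i \in l -> V (t (x i) (x j)).
  by move=> li; apply: V_mixed; apply: mixed_span_in => //; apply: lx.
move=> _ _ [i + ->] [i' + ->]; rewrite !inE => /predU1P[->|li] /predU1P[->|li'].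
- by have := Vsym j j; rewrite /sym_tensor eqxx.
- have [-> |/negbTE ji'] := eqVneq i' j.
    by have := Vsym j j; rewrite /sym_tensor eqxx.
  have := Vsym j i'; rewrite /sym_tensor eq_sym ji' => Vji.
  by have := VM _ _ Vji (VV _ (V_lj _ li')); rewrite mulgK.
- exact: V_lj.
- by apply/V_tensor/generated_in; exists (x i), (x i'); split=> //; apply: lx.
Qed.

(** Induction on a list of letters that contains those of [w], by the
factorisation [tensor_span_cons]. *)
Theorem ker_comm_sym w : d w = 1 -> sym_part w.
Proof.
have [l lw] := tensor_span_ex w; elim: l w lw => [|j l IHl] w lw dw.
  suff -> : w = 1 by apply: generated1.
  apply: (generated_sub (subgroup1 M)) lw => _ [g [h [g1 _ ->]]].
  suff -> : g = 1 by rewrite (tensor1g t_univ).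
  by apply: (generated_sub (subgroup1 G)) g1 => g' [].
have [lj|l'j] := boolP (j \in l).
  by apply: IHl dw; apply: tensor_span_mono lw => i; rewrite inE => /predU1P[->|].
have [s [m [q [ls lm Qq wE]]]] := tensor_span_cons lw.
(* The retraction that kills the letters outside [l]; it kills [d s] and fixes
   [d m]. *)
have [r rE] := free_basis_lift (fun i => if i \in l then x i else 1) basis_x.
have r_l a : letter_span l a -> r a = a.
  elim=> {a} [_ [i li ->]||a b _ IHa _ IHb|a _ IHa].
  - by rewrite rE li.
  - exact: gmulf1.
  - by rewrite gmulfM IHa IHb.
  - by rewrite gmulfV IHa.
have r_j b : letter_span [:: j] b -> r b = 1.
  move: b; apply: (generated_sub (subgroup_ker r)) => _ [i + ->].
  by rewrite inE => /eqP->; rewrite rE (negbTE l'j).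
have rds : r (d s) = 1.
  apply: (@generated_hom _ _ d _ (fun g => r g = 1) (subgroup_ker r) _ _ ls)
  => _ [a [b [_ jb ->]]].
  by rewrite tensor_commE gmulfR (r_j b jb) commg1.
have dsm : d s * d m = 1.
  by move: dw; rewrite wE !gmulfM (sym_part_ker Qq) mulg1.
have dm : d m = 1.
  have := congr1 r dsm; rewrite gmulfM rds mul1g gmulf1 r_l //.
  exact: comm_tensor_span.
have s1 : s = 1.
  apply: (@mixed_comm_inj T G M x (mem l) t d) => //.
  - exact: tensor1g.
  - exact: tensorg1.
  - exact: tensor_commE.
  - apply: generated_mono ls => _ [a [b [la jb ->]]]; exists a, b; split=> //.
    apply: generated_mono jb => _ [i + ->]; rewrite inE => /eqP->.
    by exists j.
  - by move: dsm; rewrite dm mulg1.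
by rewrite wE s1 mul1g; apply: generatedM => //; apply: IHl.
Qed.

End Kernel.

(** * Faithful representations of exterior squares *)

(** Modulo the squares [g @ g], the expansion of [gh @ gh] gives that [g @ h] and
[h @ g] are inverse to each other. *)
Lemma sym_part_normal (T : eqType) (G M : groupType) (x : T -> G) (t : G -> G -> M)
    (N : M -> Prop) :
  universal_crossed t -> normal_subgroup N -> (forall g, N (t g g)) ->
  forall w, sym_part x t w -> N w.
Proof.
move=> t_univ [N1 NM NV NJ] Nt.
apply: (@generated_sub _ _ N) => [|_ [i [j ->]]]; first by split.
rewrite /sym_tensor; case: eqP => // _.
move: (x i) (x j) => g h.
(* Expanding the square of [k h] produces the tensors of [k ^ h = g] and [h]. *)
set k := g ^ h^-1; have kh : k ^ h = g by rewrite conjgKV.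
have := Nt (k * h); rewrite (tensor_Ml t_univ) !(tensor_Mr t_univ _ k h) gmulfM.
have hh : h ^ h = h by group.
rewrite !tensor_conjE kh hh.
set n1 := t (g ^ h) (g ^ h); set n2 := t h h.
set a := t g h; set b := t h g => Nab.
have -> : a * b = a * n1 * (n2 * b) * ((n1 * n2)^-1) ^ b by group.
exact: NM _ _ Nab (NJ _ _ (NV _ (NM _ _ (Nt _) (Nt _)))).
Qed.

Lemma exterior_faithful (T : eqType) (G H : groupType) (x : T -> G) (phi : hom G H) :
  free_basis x -> injective phi -> has_faithful_rep (exterior_square G) H.
Proof.
move=> basis_x phi_inj; have t_univ := @tensor_universal G.
set A := range (fun g : G => tensor g g).
have phi1 g : phi g = 1 -> g = 1 by move=> E; apply: phi_inj; rewrite E gmulf1.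
have [f fE] : exists f : hom (tensor_square G) H,
    forall w, f w = phi (tensor_comm t_univ w).
  apply: (@hom_of_morph _ _ (fun w => phi (tensor_comm t_univ w))) => v w.
  by rewrite !gmulfM.
have [|F FE] := @quotient_ncl_lift _ H A f.
  by move=> _ [g _ <-]; rewrite fE tensor_commE commgg gmulf1.
have F_inj : forall e, F e = 1 -> e = 1.
  move=> e; have [w ->] := quotient_nclP e; rewrite FE fE => /phi1 dw.
  apply/esym/eqP/quotient_ncl_eqP; rewrite invg1 mul1g.
  apply: (sym_part_normal t_univ (normal_closure_normal A)) (ker_comm_sym basis_x dw).
  by move=> g; apply: sub_gen_smallest; exists g.
have Fi := gmulf_inj F_inj.
by exists F.
Qed.

Section Reduction.
Variable T : eqType.
Implicit Types (l : T * bool) (s : seq (T * bool)).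

Definition inv_letter l := (l.1, ~~ l.2).
Definition reduced s := sorted (fun l l' => l' != inv_letter l) s.

Definition push l s :=
  if s is l' :: s' then if l' == inv_letter l then s' else l :: s else [:: l].

Lemma reduced_push l s : reduced s -> reduced (push l s).
Proof.
case: s => [|l' s] //= ls; case: eqP => [_|/eqP l'l] /=; last by rewrite l'l.
exact: path_sorted ls.
Qed.

End Reduction.

Lemma reduced_word (T : choiceType) (g : free_group T) :
  exists2 s, reduced s & g = \pi_(free_group T) s.
Proof.
have [s ->] := free_groupP g; elim: s => [|l s [s' s'red E]]; first by exists [::].
exists (push l s'); first exact: reduced_push.
have E' : word_equiv (l :: s) (l :: s').
  rewrite -(cat1s l s) -(cat1s l s'); apply: word_equiv_cat; first exact: word_refl.
  exact/free_group_eqP/eqP.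
apply/eqP/free_group_eqP/(word_trans E'); case: s' {s'red E E'} => [|l' s'] /=.
  exact: word_refl.
case: eqP => [->|_]; last exact: word_refl.
by case: l => y b; apply: (@word_cancel _ [::] s').
Qed.

Lemma det_mx2 (R : comNzRingType) (A : 'M[R]_2) :
  (\det A = A 0 0 * A 1 1 - A 0 1 * A 1 0)%R.
Proof.
rewrite (expand_det_row _ 0%R) !big_ord_recl big_ord0 /cofactor !det_mx11 !mxE /=.
rewrite GRing.expr0 GRing.expr1 GRing.mul1r GRing.addr0 GRing.mulN1r GRing.mulrN.
by congr (A _ _ * A _ _ - A _ _ * A _ _)%R; apply: val_inj.
Qed.

Lemma ord01 : ((ord0 = 0%R :> 'I_2) * (lift ord0 ord0 = 1%R :> 'I_2))%type.
Proof. by split; apply: val_inj. Qed.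

Section PingPong.
Import Order.TTheory GRing.Theory Num.Theory.
Local Open Scope ring_scope.
Variables (T : choiceType) (code : T -> nat).
Hypothesis code_inj : injective code.
Implicit Types (l : T * bool) (v : int * int).

(** Letters are indexed by integers at mutual distance at least 2, so that the
open discs of radius 1 around them are disjoint. *)
Definition center l : int := (4 * code l.1 + 2 * l.2)%N.

Lemma center_sep l l' : l != l' -> 2 <= `|center l - center l'|.
Proof.
case: l l' => [y b] [y' b'] ll'; rewrite /center /=.
have [E|] := eqVneq (code y) (code y'); last by case: b b' {ll'} => -[]; lia.
move/code_inj: E ll' => ->; rewrite xpair_eqE eqxx.
by case: b b' => -[] //= _; lia.
Qed.

(** With [e] and [e'] the centres of a generator and of its inverse, this is the
Moebius map sending [p] to [e - 1 / (p - e')].  It maps the outside of the disc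
around [e'] into the disc around [e], and its inverse is obtained, up to sign,
by exchanging [e] and [e']. *)
Definition sl_mx y : 'M[int]_2 :=
  let e := center (y, false) in let e' := center (y, true) in
  \matrix_(i, j) if i == 0 then if j == 0 then e else - 1 - e * e'
                 else if j == 0 then 1 else - e'.

Lemma det_sl_mx y : \det (sl_mx y) == 1.
Proof. rewrite det_mx2 !mxE /=; apply/eqP; ring. Qed.

Definition sl_gen y : SL 2 int := exist _ (sl_mx y) (det_sl_mx y).

(** The column [v] stands for the point [v.1 / v.2] of the projective line. *)
Definition disc l v := `|v.1 - center l * v.2| < `|v.2|.

(** The image under [A] of the point at infinity.  That point lies outside all
the discs, and the ping-pong starts from it. *)
Definition col1 (A : SL 2 int) : int * int := (val A 0 0, val A 1 0).

(** The inverse of [sl_mx y], given explicitly because it is not obtained by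
exchanging the two centres: that matrix has the opposite sign. *)
Definition sl_mxV y : 'M[int]_2 :=
  let e := center (y, false) in let e' := center (y, true) in
  \matrix_(i, j) if i == 0 then if j == 0 then - e' else 1 + e * e'
                 else if j == 0 then - 1 else e.

Lemma det_sl_mxV y : \det (sl_mxV y) == 1.
Proof. rewrite det_mx2 !mxE /=; apply/eqP; ring. Qed.

Definition sl_genV y : SL 2 int := exist _ (sl_mxV y) (det_sl_mxV y).

Lemma sl_genVE y : sl_genV y = (sl_gen y)^-1%g.
Proof.
apply/esym/mulg1_eq/val_inj/matrixP => i j; rewrite !mxE big_ord_recl big_ord1 !mxE /=.
by case: i j => [[|[|//]] ?] [[|[|//]] ?] /=; ring.
Qed.

Definition sl_letter l := if l.2 then sl_genV l.1 else sl_gen l.1.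

Lemma sl_letter_disc l (A : SL 2 int) :
  `|(col1 A).2| < `|(col1 A).1 - center (inv_letter l) * (col1 A).2| ->
  disc l (col1 (sl_letter l * A)%g).
Proof.
case: l => y b; rewrite /disc /col1 /sl_letter /inv_letter /=.
case: b; rewrite /= !mxE !big_ord_recl !big_ord0 !mxE /=.
  rewrite !ord01 /=.
  move: (val A 0 0) (val A 1 0) (center (y, true)) (center (y, false)) => p q e' e.
  rewrite [X in _ -> X < _](_ : _ = `|q|); last by congr (`|_|); ring.
  rewrite [X in _ -> _ < X](_ : _ = `|p - e * q|) //.
  by rewrite -[RHS]normrN; congr (`|_|); ring.
rewrite !ord01 /=.
move: (val A 0 0) (val A 1 0) (center (y, true)) (center (y, false)) => p q e' e.
rewrite [X in _ -> X < _](_ : _ = `|q|); last by rewrite -[RHS]normrN; congr (`|_|); ring.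
by rewrite [X in _ -> _ < X](_ : _ = `|p - e' * q|) //; congr (`|_|); ring.
Qed.

(** Once [l'] has moved the point into its disc, the disc around the inverse of
the next letter [l] is a different one, since [l] does not cancel [l']; so the
point lies outside it and [l] moves the point into its own disc. *)
Lemma ping_pong (f : hom (free_group T) (SL 2 int)) s l :
  (forall y, f (free_gen y) = sl_gen y) ->
  reduced (l :: s) -> disc l (col1 (f (\pi_(free_group T) (l :: s)))).
Proof.
move=> fE.
have f_cons l' s' : f (\pi_(free_group T) (l' :: s')) =
    (sl_letter l' * f (\pi_(free_group T) s'))%g.
  have -> : \pi_(free_group T) (l' :: s') =
      (\pi_(free_group T) [:: l'] * \pi_(free_group T) s')%g.
    by rewrite -[RHS]/(free_mul _ _) free_mulE.
  rewrite gmulfM; congr (_ * _)%g; case: l' => y [|]; rewrite /sl_letter /= -?fE //.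
  rewrite sl_genVE -fE -gmulfV; congr (f _).
  by rewrite -[RHS]/(free_inv _) free_invE.
elim: s l => [|l' s IHs] l; rewrite f_cons => red_s; apply: sl_letter_disc.
  have -> : f (\pi_(free_group T) [::]) = 1%g by exact: gmulf1.
  by rewrite /col1 !mxE /= mulr0.
have /andP[l'l red_s'] : (l' != inv_letter l) && reduced (l' :: s) by [].
have := IHs l' red_s'; have := center_sep l'l; rewrite /disc.
move: (col1 _) (center l') (center (inv_letter l)) => [p q] e e' /=.
have -> : p - e' * q = (p - e * q) + (e - e') * q by ring.
move=> sep; have : 2 * `|q| <= `|(e - e') * q| by rewrite normrM ler_wpM2r.
by move: ((e - e') * q) (p - e * q) => X Y; lia.
Qed.

Theorem free_group_SL2 : exists f : hom (free_group T) (SL 2 int), injective f.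
Proof.
have [f fE] := free_basis_lift sl_gen (@free_gen_basis T).
exists f; apply: gmulf_inj => g; have [[|l s] red_s ->] := reduced_word g; first by [].
move=> f1; have := ping_pong fE red_s; rewrite f1 /disc /col1 !mxE /=.
by rewrite normr0 ltNge normr_ge0.
Qed.

End PingPong.

(** * Positive rational characters and the tensor square *)

Section PositiveRationals.
Import Order.TTheory GRing.Theory Num.Theory.
Local Open Scope ring_scope.

Definition pos_rat := {y : rat | 0 < y}.
HB.instance Definition _ := Choice.on pos_rat.
Implicit Types y z : pos_rat.

Definition pos_rat_one : pos_rat := exist _ 1 ltr01.
Definition pos_rat_mul y z : pos_rat := exist _ (val y * val z) (mulr_gt0 (valP y) (valP z)).

Lemma pos_rat_inv_subproof y : 0 < (val y)^-1.
Proof. by rewrite invr_gt0 (valP y). Qed.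
Definition pos_rat_inv y : pos_rat := exist _ (val y)^-1 (pos_rat_inv_subproof y).

Lemma pos_rat_mulA : associative pos_rat_mul.
Proof. by move=> y z w; apply/val_inj/mulrA. Qed.
Lemma pos_rat_mul1 : left_id pos_rat_one pos_rat_mul.
Proof. by move=> y; apply/val_inj/mul1r. Qed.
Lemma pos_rat_mulr1 : right_id pos_rat_one pos_rat_mul.
Proof. by move=> y; apply/val_inj/mulr1. Qed.
Lemma pos_rat_mulV : left_inverse pos_rat_one pos_rat_inv pos_rat_mul.
Proof. by move=> y; apply/val_inj/mulVf; rewrite gt_eqF ?(valP y). Qed.
Lemma pos_rat_mulrV : right_inverse pos_rat_one pos_rat_inv pos_rat_mul.
Proof. by move=> y; apply/val_inj/divff; rewrite gt_eqF ?(valP y). Qed.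

HB.instance Definition _ := isGroup.Build pos_rat
  pos_rat_mulA pos_rat_mul1 pos_rat_mulr1 pos_rat_mulV pos_rat_mulrV.

Lemma pos_rat_mulC y z : (y * z = z * y)%g.
Proof. exact/val_inj/mulrC. Qed.

Definition valuation p y : int :=
  (logn p `|numq (val y)|)%:Z - (logn p `|denq (val y)|)%:Z.

Lemma valuationM p y z : valuation p (y * z)%g = valuation p y + valuation p z.
Proof.
rewrite /valuation; have -> : val (y * z)%g = val y * val z by [].
move: (val y) (val z) (valP y) (valP z) => {y z} a b a0 b0.
have E : numq (a * b) * (denq a * denq b) = numq a * numq b * denq (a * b).
  apply: (@intr_inj rat); rewrite !intrM !numqE; ring.
have num_gt0 (c : rat) : 0 < c -> (0 < `|numq c|)%N by rewrite -numq_gt0; lia.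
have den_gt0 (c : rat) : (0 < `|denq c|)%N by have := denq_gt0 c; lia.
have := congr1 (logn p \o absz) E; rewrite /= !abszM.
rewrite !lognM ?muln_gt0 ?num_gt0 ?den_gt0 ?mulr_gt0 //; lia.
Qed.

Lemma valuation1 p : valuation p 1%g = 0.
Proof. by have := valuationM p 1%g 1%g; rewrite mulg1; lia. Qed.

Lemma valuationV p y : valuation p y^-1%g = - valuation p y.
Proof. by have := valuationM p y y^-1%g; rewrite mulgV valuation1; lia. Qed.

Lemma valuation_prime p r y :
  prime p -> prime r -> val y = r%:R -> valuation p y = (p == r)%:R.
Proof.
case: y => y y0 pp pr /= yr; rewrite /valuation /= yr -[r%:R]/(r%:~R) numq_int denq_int.
by rewrite logn1 subr0 logn_prime // natz.
Qed.

End PositiveRationals.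

(** For an [i] that is not in the list, [w] is a power of [q i] times a product of
the other [q j], and the [p i]-adic valuation of [z w] is the exponent of that
power. *)
Lemma primes_independent (M : groupType) (I : eqType) (q : I -> M)
    (z : hom M pos_rat) (p : I -> nat) :
  (forall i m, commute (q i) m) -> injective p -> (forall i, prime (p i)) ->
  (forall i, val (z (q i)) = (p i)%:R%R) ->
  forall w, generated (fun m => exists i, m = q i) w -> z w = 1 -> w = 1.
Proof.
move=> qC p_inj p_prime zq.
pose gen (l : seq I) := generated (fun m => exists2 i, i \in l & m = q i).
have gen_mono l l' : {subset l <= l'} -> forall w, gen l w -> gen l' w.
  by move=> ll'; apply: generated_mono => _ [i /ll' ? ->]; exists i.
have gen_ex w : generated (fun m => exists i, m = q i) w -> exists l, gen l w.
  elim=> {w} [_ [i ->]||v w _ [l lv] _ [l' lw]|w _ [l lw]].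
  - by exists [:: i]; apply: generated_in; exists i; rewrite ?inE.
  - by exists [::]; apply: generated1.
  - exists (l ++ l'); apply: generatedM.
      by apply: gen_mono lv => i; rewrite mem_cat => ->.
    by apply: gen_mono lw => i; rewrite mem_cat => ->; rewrite orbT.
  - by exists l; apply: generatedV.
move=> w /gen_ex[l]; elim: l w => [|i l IHl] w lw zw.
  by apply: (generated_sub (subgroup1 M)) lw => m [].
have [li|l'i] := boolP (i \in l).
  by apply: IHl zw; apply: gen_mono lw => j; rewrite inE => /predU1P[->|].
(* The exponent of [q i] in [w] is the integer [a - b]. *)
have [a [b [v [lv wE]]]] : exists a b v, gen l v /\ w * q i ^+ b = q i ^+ a * v.
  elim: lw {zw} => {w} [_ [j + ->]||v w _ [a [b [v' [lv vE]]]] _ [a' [b' [w' [lw wE]]]]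
                       |w _ [a [b [v [lv wE]]]]].
  - rewrite inE => /predU1P[->|lj].
      by exists 1%N, 0%N, 1; split; rewrite ?mulg1 //; apply: generated1.
    exists 0%N, 0%N, (q j); split; rewrite ?mulg1 ?mul1g //.
    by apply: generated_in; exists j.
  - by exists 0%N, 0%N, 1; split; rewrite ?mulg1 //; apply: generated1.
  - exists (a + a'), (b' + b), (v' * w'); split; first exact: generatedM.
    have qXC n m : m * q i ^+ n = q i ^+ n * m by apply/commuteX/commute_sym.
    rewrite expgnDr mulgA -[v * w * _]mulgA wE mulgA (qXC a' v) -[_ * w' * _]mulgA.
    by rewrite (qXC b w') mulgA -[_ * v * _]mulgA vE addnC expgnDr !mulgA.
  - exists b, a, v^-1; split; first exact: generatedV.
    by apply: (@mulgI _ w); rewrite mulVKg [RHS]mulgA wE mulgK.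
have val_v u : gen l u -> valuation (p i) (z u) = 0%R.
  elim=> {u} [_ [j lj ->]||u u' _ IHu _ IHu'|u _ IHu].
  - rewrite (valuation_prime (p_prime i) (p_prime j) (zq j)).
    by case: eqP => // /p_inj ij; rewrite -ij (negbTE l'i) in lj.
  - by rewrite gmulf1 valuation1.
  - by rewrite gmulfM valuationM IHu IHu'.
  - by rewrite gmulfV valuationV IHu.
have val_q n : valuation (p i) (z (q i ^+ n)) = n%:R%R.
  elim: n => [|n IHn]; first by rewrite gmulf1 valuation1.
  rewrite expgS gmulfM valuationM IHn (valuation_prime (p_prime i) (p_prime i) (zq i)).
  by rewrite eqxx; lia.
have ab : a = b.
  have := congr1 (valuation (p i) \o z) wE; rewrite /= !gmulfM !valuationM zw.
  by rewrite valuation1 (val_v _ lv) !val_q; lia.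
have wv : w = v.
  apply: (@mulIg _ (q i ^+ b)); rewrite wE ab.
  by apply/esym/commuteX/commute_sym.
by rewrite wv; apply: IHl; rewrite // -wv.
Qed.

Lemma prime_seq : exists2 p : nat -> nat, injective p & forall n, prime (p n).
Proof.
pose next m := s2val (prime_above m).
have next_gt m : m < next m := s2valP (prime_above m).
pose p := fix p n := if n is n'.+1 then next (p n') else 2.
exists p => [|[|n]//]; last by rewrite /= /next; case: prime_above.
have p_homo : {homo p : m n / m < n}.
  by apply: homo_ltn => [? ? ?|?]; [exact: ltn_trans|exact: next_gt].
by move=> m n pmn; case: (ltngtP m n) => // /p_homo; rewrite pmn ltnn.
Qed.

(** Lift in the second variable for each basis element, then in the first one
for each fixed second argument. *)
Lemma bilinear_lift (T : Type) (G H : groupType) (x : T -> G) (c : T -> T -> H) :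
  (forall y z : H, y * z = z * y) -> free_basis x ->
  exists b : G -> G -> H,
    [/\ forall g g' h, b (g * g') h = b g h * b g' h,
        forall g h h', b g (h * h') = b g h * b g h'
      & forall i j, b (x i) (x j) = c i j].
Proof.
move=> HC basis_x.
have [r rE] := choice (fun i => free_basis_lift (c i) basis_x).
have [b bE] := choice (fun h => free_basis_lift (fun i => r i h) basis_x).
exists (fun g h => b h g); split=> [g g' h|g h h'|i j].
- exact: gmulfM.
- elim: (basis_x.1 g) => {g} [_ [i ->]||g g' _ IHg _ IHg'|g _ IHg].
  + by rewrite !bE gmulfM.
  + by rewrite !gmulf1 mulg1.
  + rewrite !gmulfM IHg IHg' -!mulgA; congr (_ * _).
    by rewrite !mulgA; congr (_ * _); apply: HC.
  + by rewrite !gmulfV IHg invgM HC.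
- by rewrite bE rE.
Qed.

(** The bilinear map is chosen asymmetric: of its values at [(x i, x j)] and
[(x j, x i)], for [i] and [j] distinct, one is 1 and the other is a prime
attached to the pair.  So distinct symmetric elements are sent to distinct
primes, not to products of two of them. *)
Theorem sym_part_detect (T : choiceType) (G M : groupType) (x : T -> G)
    (t : G -> G -> M) (code : T -> nat) :
  free_basis x -> universal_crossed t -> injective code ->
  exists z : hom M pos_rat, forall w, sym_part x t w -> z w = 1 -> w = 1.
Proof.
move=> basis_x t_univ code_inj.
have [p p_inj p_prime] := prime_seq.
pose pr (ij : T * T) := p (pickle (code ij.1, code ij.2)).
have pr_inj : injective pr.
  move=> [i j] [i' j'] /p_inj/(pcan_inj pickleK) [].
  by move=> /code_inj-> /code_inj->.
have pr_gt0 ij : (0 < (pr ij)%:R :> rat)%R.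
  by rewrite Num.Theory.ltr0n (prime_gt0 (p_prime _)).
pose c i j : pos_rat :=
  if code i <= code j then (exist _ (pr (i, j))%:R%R (pr_gt0 (i, j)) : pos_rat) else 1.
have [b [bMl bMr bx]] := bilinear_lift c pos_rat_mulC basis_x.
have bJl g k h : b (g ^ k) h = b g h.
  apply: (@mulgI _ (b k h)); rewrite -bMl -conjgC bMl; exact: pos_rat_mulC.
have bJr g h k : b g (h ^ k) = b g h.
  apply: (@mulgI _ (b g k)); rewrite -bMr -conjgC bMr; exact: pos_rat_mulC.
have [_ _ /(_ pos_rat b) []] := t_univ.
  split=> [g k h|g h k]; first by rewrite bMl bJl bJr.
  by rewrite bMr bJl bJr pos_rat_mulC.
move=> z zE; exists z => w.
(* Each symmetric element is counted once, with its letters in the order of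
   their codes. *)
pose I := {ij : T * T | code ij.1 <= code ij.2}.
pose q (ij : I) := sym_tensor x t (val ij).1 (val ij).2.
have sym_q : forall m, sym_part x t m -> generated (fun m => exists i : I, m = q i) m.
  apply: generated_mono => _ [i [j ->]].
  case/orP: (leq_total (code i) (code j)) => ij.
    by exists (exist _ (i, j) ij).
  by exists (exist _ (j, i) ij); rewrite (sym_tensorC _ t_univ).
move=> /sym_q; apply: (@primes_independent _ I q z (pr \o val)).
- move=> ij m; apply: (ker_comm_central (t_univ := t_univ)); apply: (sym_part_ker (x := x)).
  by apply: generated_in; exists (val ij).1, (val ij).2.
- exact: inj_comp pr_inj val_inj.
- by move=> ij; apply: p_prime.
- move=> [[i j] /= ij]; rewrite /q /sym_tensor /=; case: eqP => [<-|ne].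
    by rewrite zE bx /c leqnn.
  rewrite gmulfM !zE !bx /c ij leqNgt ltn_neqAle ij andbT.
  by case: eqP => [/code_inj/ne|_] /=; rewrite ?GRing.mulr1.
Qed.

Section ScaledRepresentation.
Import Order.TTheory GRing.Theory Num.Theory.
Local Open Scope ring_scope.
Variable K : numFieldType.
Implicit Types (y : pos_rat) (A : SL 2 int).

Lemma scalar_unitmx y : (ratr (val y))%:M \in unitmx (R := K) (n := 2).
Proof.
by rewrite unitmxE det_scalar unitfE expf_neq0 // fmorph_eq0 gt_eqF ?(valP y).
Qed.

Definition scalar_rep y : GL 2 K := exist _ (ratr (val y))%:M (scalar_unitmx y).

Lemma intr_unitmx A : map_mx (intr : int -> K) (val A) \in unitmx.
Proof. by rewrite unitmxE det_map_mx (eqP (valP A)) rmorph1 unitr1. Qed.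

Definition intr_rep A : GL 2 K := exist _ (map_mx intr (val A)) (intr_unitmx A).

Definition scaled_rep (p : pos_rat * SL 2 int) : GL 2 K :=
  (scalar_rep p.1 * intr_rep p.2)%g.

Lemma scaled_repM p p' :
  scaled_rep (p.1 * p'.1, p.2 * p'.2)%g = (scaled_rep p * scaled_rep p')%g.
Proof.
case: p p' => y A [y' A']; apply: val_inj => /=.
rewrite [ratr _]rmorphM map_mxM scalar_mxM -!mulmxA; congr (_ *m _).
by rewrite !mulmxA [_ *m _%:M]scalar_mxC.
Qed.

(** The determinant of the product is the square of the scalar, which is positive;
so the scalar is 1. *)
Lemma scaled_rep_inj p : scaled_rep p = 1%g -> p = (1%g, 1%g).
Proof.
case: p => y A /(congr1 val) /= yA.
have y1 : y = 1%g.
  have := congr1 determinant yA.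
  rewrite det_mulmx det_scalar det_map_mx (eqP (valP A)) rmorph1 mulr1 det1 => /eqP.
  rewrite -rmorphXn fmorph_eq1 sqrf_eq1 => /orP[/eqP E|/eqP E]; first exact: val_inj.
  by have : 0 < sval y := valP y; rewrite E.
have A1 : map_mx (intr : int -> K) (sval A) = 1%:M.
  by move: yA; rewrite y1 /= rmorph1 mul1mx.
congr (_, _) => //; apply/val_inj/matrixP => i j.
by have /matrixP/(_ i j) := A1; rewrite !mxE -mulrz_nat => /intr_inj ->; rewrite natz.
Qed.

End ScaledRepresentation.

Theorem universal_crossed_faithful (K : numFieldType) (T : choiceType) (G M : groupType)
    (x : T -> G) (t : G -> G -> M) (code : T -> nat) (phi : hom G (SL 2 int)) :
  free_basis x -> universal_crossed t -> injective code -> injective phi ->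
  has_faithful_rep M (GL 2 K).
Proof.
move=> basis_x t_univ code_inj phi_inj.
have [z z_inj] := sym_part_detect basis_x t_univ code_inj.
have [|f fE] := @hom_of_morph M (GL 2 K)
    (fun w => scaled_rep K (z w, phi (tensor_comm t_univ w))).
  move=> v w; set d := tensor_comm t_univ.
  apply: etrans (scaled_repM K (z v, phi (d v)) (z w, phi (d w))).
  by rewrite (gmulfM (s := z)) (gmulfM (s := d)) (gmulfM (s := phi)).
have f_inj : forall w, f w = 1 -> w = 1.
  move=> w; rewrite fE => /scaled_rep_inj [zw phidw].
  apply: z_inj zw; apply: (ker_comm_sym basis_x (_ : tensor_comm t_univ w = 1)).
  by apply: phi_inj; rewrite phidw gmulf1.
have fi := gmulf_inj f_inj.
by exists f.
Qed.

Theorem proposition6p1 (R : realType) (G : groupType)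
    (G_free : is_free G) (G_countable : countable [set: G]%classic) :
  has_faithful_rep (exterior_square G) (SL 2 int) /\
  has_faithful_rep (tensor_square G) (GL 2 R[i]).
Proof.
have [T [f0 f0_bij]] := G_free.
have [f fE] := hom_of_morph (gmulfM (s := f0)).
have f_bij : bijective f by apply: (eq_bij f0_bij) => g; rewrite fE.
have basis_x := free_basis_iso f_bij (@free_gen_basis T).
have /countable_injP[c c_inj] := G_countable.
pose code t := c (f (free_gen t)).
have code_inj : injective code.
  by move=> i j /(c_inj _ _ (in_setT _) (in_setT _))/(free_basis_inj basis_x).
have [phi0 phi0_inj] := free_group_SL2 code_inj.
have [f' fK f'K] := f_bij.
have [phi phiE] : exists phi : hom G (SL 2 int), phi =1 phi0 \o f'.
  by apply: hom_of_morph => g h /=; rewrite (can2_gmulfM fK f'K) gmulfM.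
have phi_inj : injective phi.
  by move=> g h; rewrite !phiE => /phi0_inj/(can_inj f'K).
split; first exact: exterior_faithful basis_x phi_inj.
exact: universal_crossed_faithful basis_x (@tensor_universal G) code_inj phi_inj.
Qed.
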